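(* Each group diagram of a finite group can be converted, by cyclic orderings of the generator symbols, to a regular covering of an oriented manifold. Precisely: let $\mathfrak G$ be a finite group with generators $S_1,\dots,S_r$, let $\mathfrak C$ be its group diagram, and let any cyclic ordering of the $2r$ symbols $S_1^{\pm1},\dots,S_r^{\pm1}$ be given. Order the segments emanating from each point of $\mathfrak C$ cyclically in accordance with the symbols they carry. Then there is an oriented manifold $\mathfrak M$ whose line segment complex is $\mathfrak C$ and whose simple positive boundary paths are exactly the boundary paths determined by these cyclic orderings, and there is a manifold $\mathfrak M^*$ with a single point $p^*$ and segments $s_1^{*\pm1},\dots,s_r^{*\pm 1}$ such that the mapping sending each segment carrying $S_i^{\pm1}$ to $s_i^{*\pm1}$ extends to a regular (branched or unbranched) covering of $\mathfrak M^*$ by $\mathfrak M$.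
   Context: A line segment complex consists of points and directed segments; each segment $s$ has an initial and a final point and an oppositely directed segment $s^{-1}\ne s$, $(s^{-1})^{-1}=s$, with initial and final point exchanged. Group diagram of $\mathfrak G$: its points are the elements $F$ of $\mathfrak G$; for each $F$ and $i$ there is a segment from $F$ to $FS_i$ carrying the symbol $S_i$, whose oppositely directed segment carries $S_i^{-1}$ (so exactly $2r$ segments emanate from each point, one for each symbol). Boundary paths determined by the orderings: a closed path $s_1s_2\cdots s_m$ is a positive boundary path if for each $i$ (indices mod $m$) the segment $s_{i+1}$ is the immediate successor of $s_i^{-1}$ in the cyclic order of segments emanating from their common initial point; it is simple if no proper subpath is likewise such a boundary path. A surface complex is a line segment complex together with surface pieces $f$; each $f$ has an opposite $f^{-1}\neq f$, $(f^{-1})^{-1}=f$, and a closed path, determined up to cyclic interchange, circumscribing $f$ once positively (a simple positive boundary path of $f$); if $w$ is one for $f$, then $w^{-1}$ is one for $f^{-1}$. A manifold is a surface complex such that: (1) the line segment complex is connected; (2) every segment occurs in the boundary of some surface piece; (3) a simple boundary path runs through a segment (in either direction) at most twice; if the boundary path of $f$ runs through $s$ once, there is, up to orientation, exactly one surface piece $f'\neq f^{\pm1}$ whose boundary runs through $s$, and it does so once; if the boundary path of $f$ runs through $s$ twice, $s$ bounds only $f^{\pm1}$; (4) at every point $p$, any two segments beginning at $p$ can be joined by a sequence of segments $s_1,\dots,s_m$ beginning at $p$ such that $s_i^{-1}s_{i+1}$ is a (cyclic) subpath of a boundary path, and $s_{i-1},s_{i+1}$ come from the two different passages of boundary paths through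 $s_i$. A manifold is oriented if one surface piece of each pair $f^{\pm1}$ is chosen as positive so that the simple positive boundary paths of the chosen pieces together run through each segment exactly once in each direction; ''simple positive boundary paths of $\mathfrak M$'' refers to the chosen pieces. Covering (possibly branched) $\boldsymbol A(\mathfrak M)=\mathfrak M^*$: a map of points, segments, surface pieces, surjective on points, such that (a) initial points are preserved, $\boldsymbol A(s^{-1})=\boldsymbol A(s)^{-1}$, $\boldsymbol A(f^{-1})=\boldsymbol A(f)^{-1}$, and the segments beginning at $p$ are mapped bijectively onto those beginning at $\boldsymbol A(p)$; (b) if $r$ is a simple positive boundary path of $f$, then $\boldsymbol A(r)={r^*}^k$ for a simple positive boundary path $r^*$ of $\boldsymbol A(f)$, and, writing $r=w_1\cdots w_k$ with $\boldsymbol A(w_i)=r^*$, the $w_i$ are pairwise distinct; (c) if $r^*$ is a simple positive boundary path of $f^*$ and $w'$ is a path with $\boldsymbol A(w')=r^*$, there is exactly one surface piece $f'$ over $f^*$ in whose simple positive boundary path (suitably cyclically interchanged) $w'$ occurs as initial subpath. The covering is regular if, whenever $\boldsymbol A(w)=\boldsymbol A(w')$ and the path $w$ is closed, $w'$ is closed. *)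

(* Defs.v *)
(* Over the Mathematical Components library. *)
From HB Require Import structures.
From mathcomp Require Import all_boot all_fingroup.

Set Implicit Arguments.
Unset Strict Implicit.
Unset Printing Implicit Defensive.

(** * Line segment complexes *)

Record lineComplex := LineComplex {
  point : eqType;
  segment : eqType;
  init : segment -> point;
  inv : segment -> segment;
  inv_neq : forall s, inv s != s;
  invK : involutive inv }.

Section Paths.
Variable L : lineComplex.
Implicit Types (s t : segment L) (w u : seq (segment L)).

Definition final s : point L := init (inv s).

Definition follows s t : bool := final s == init t.

Definition is_path w : bool := sorted follows w.

(* A closed path runs through at least one segment. *)
Definition closed_path w : bool := (w != [::]) && path.cycle follows w.

Definition path_inv w : seq (segment L) := rev (map (@inv L) w).

Definition connected : Prop :=
  forall p q : point L, p = q \/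
    exists s w, [/\ init s = p, path follows s w & final (last s w) = q].

(* For a family of cyclic orderings of the segments emanating from each point,
   given by its immediate-successor function [nxt]. *)
Definition order_boundary (nxt : segment L -> segment L) w : bool :=
  closed_path w && fcycle (fun s => nxt (inv s)) w.

Definition simple_order_boundary (nxt : segment L -> segment L) w : Prop :=
  order_boundary nxt w /\
  forall u, infix u w -> u <> w -> ~~ order_boundary nxt u.

End Paths.

(** * Surface complexes and manifolds *)

(* [bd f] is one representative of the closed path, determined up to cyclic
   interchange, that circumscribes [f] once positively. *)
Record surfaceComplex (L : lineComplex) := SurfaceComplex {
  piece : eqType;
  pinv : piece -> piece;
  pinv_neq : forall f, pinv f != f;
  pinvK : involutive pinv;
  bd : piece -> seq (segment L);
  bd_closed : forall f, closed_path (bd f);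
  bd_inv : forall f, exists n, path_inv (bd f) = rot n (bd (pinv f)) }.

Section Manifolds.
Variables (L : lineComplex) (M : surfaceComplex L).
Implicit Types (f : piece M) (s t u : segment L) (w : seq (segment L)).

(* [w] is a simple positive boundary path of [f]. *)
Definition boundary_path f w : Prop := exists n, w = rot n (bd f).

(* Number of times the boundary of [f] runs through [s], in either direction. *)
Definition runs f s : nat :=
  count_mem s (bd f) + count_mem (inv s) (bd f).

(* [s^-1 t] is the cyclic subpath of [bd f] at positions [j], [j + 1] modulo
   the length of [bd f]; the default value of [nth] is never reached. *)
Definition corner f (j : nat) s t : Prop :=
  [/\ j < size (bd f), nth s (bd f) j = inv s
    & nth s (bd f) (j.+1 %% size (bd f)) = t].

(* [s] and [u] come from the two different passages of boundary paths through
   [t].  Since a passage through [t^-1] in [f] is, up to orientation, a passage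
   through [t] in [f^-1], passages through [t] are normalised to occurrences of
   [t] itself; thus the subpath [t^-1 u] is read in the opposite piece, as
   [u^-1 t]. A passage is named by the piece and the position of the segment
   which precedes [t]. *)
Definition turn s t u : Prop :=
  exists f j f' j', [/\ corner f j s t, corner f' j' u t & (f, j) != (f', j')].

Definition joined_around (c : seq (segment L)) : Prop :=
  (forall c1 c2 s t, c = c1 ++ [:: s, t & c2] -> exists f j, corner f j s t) /\
  (forall c1 c2 s t u, c = c1 ++ [:: s, t, u & c2] -> turn s t u).

Record is_manifold : Prop := IsManifold {
  manifold_connected : connected L;
  manifold_covered : forall s, exists f, 0 < runs f s;
  manifold_runs_le2 : forall f s, runs f s <= 2;
  manifold_runs1 : forall f s, runs f s = 1 ->
    exists f', [/\ f' <> f, f' <> pinv f, runs f' s = 1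
      & forall g, g <> f -> g <> pinv f -> 0 < runs g s ->
          g = f' \/ g = pinv f'];
  manifold_runs2 : forall f s, runs f s = 2 ->
    forall g, 0 < runs g s -> g = f \/ g = pinv f;
  manifold_star : forall s t, init s = init t ->
    exists c, [/\ forall u, u \in c -> init u = init s, last s c = t
                & joined_around (s :: c)] }.

(* [pos] singles out the positive piece of each pair [f], [f^-1].  The
   condition is on directed segments, so it covers both directions. *)
Record is_orientation (pos : pred (piece M)) : Prop := IsOrientation {
  orientation_choice : forall f, pos (pinv f) = ~~ pos f;
  orientation_once : forall s, exists f, [/\ pos f, count_mem s (bd f) = 1
    & forall g, pos g -> s \in bd g -> g = f] }.

End Manifolds.

(** * Coverings *)

Record complexMap (L L' : lineComplex)
    (M : surfaceComplex L) (M' : surfaceComplex L') := ComplexMap {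
  point_map : point L -> point L';
  segment_map : segment L -> segment L';
  piece_map : piece M -> piece M' }.

Section Coverings.
Variables (L L' : lineComplex) (M : surfaceComplex L) (M' : surfaceComplex L').
Variable A : complexMap M M'.

(* In [covering_boundary], [nseq k r'] flattens to the power [r' ^ k], and
   [ws] is the list of the [w_i]. *)
Record is_covering : Prop := IsCovering {
  covering_onto : forall p', exists p, point_map A p = p';
  covering_init : forall s, init (segment_map A s) = point_map A (init s);
  covering_inv : forall s, segment_map A (inv s) = inv (segment_map A s);
  covering_pinv : forall f, piece_map A (pinv f) = pinv (piece_map A f);
  covering_star : forall p s', init s' = point_map A p ->
    exists! s, init s = p /\ segment_map A s = s';
  covering_boundary : forall f r, boundary_path f r ->
    exists k r' ws,
      [/\ boundary_path (piece_map A f) r',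
          map (segment_map A) r = flatten (nseq k r'),
          r = flatten ws,
          map (map (segment_map A)) ws = nseq k r'
        & uniq ws];
  covering_lift : forall f' r' w, boundary_path f' r' ->
    is_path w -> map (segment_map A) w = r' ->
    exists! f, piece_map A f = f' /\ exists v, boundary_path f (w ++ v) }.

Definition regular : Prop :=
  forall w w', is_path w -> is_path w' ->
    map (segment_map A) w = map (segment_map A) w' ->
    closed_path w -> closed_path w'.

End Coverings.

(** * Group diagrams *)

(* [(i, true)] is the symbol S_i and [(i, false)] the symbol S_i^-1; the 2r
   symbols are distinct even when the group elements they denote are not. *)
Definition symbol (r : nat) : eqType := ('I_r * bool)%type.

Definition symbol_inv r (x : symbol r) : symbol r := (x.1, ~~ x.2).

Lemma symbol_inv_neq r (x : symbol r) : symbol_inv x != x.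
Proof. by case: x => i [] /=; rewrite xpair_eqE eqxx. Qed.

Lemma symbol_invK r : involutive (@symbol_inv r).
Proof. by case=> i b; rewrite /symbol_inv /= negbK. Qed.

(* The complex with one point and segments s_1^{+-1}, ..., s_r^{+-1}. *)
Definition bouquet (r : nat) : lineComplex :=
  @LineComplex unit (symbol r) (fun=> tt) (@symbol_inv r)
    (@symbol_inv_neq r) (@symbol_invK r).

Section GroupDiagram.
Variables (gT : finGroupType) (r : nat) (S : 'I_r -> gT).

Definition symbol_val (x : symbol r) : gT :=
  if x.2 then S x.1 else ((S x.1)^-1)%g.

(* [(F, x)] is the segment which starts at [F] and carries the symbol [x]. *)
Definition dsegment : eqType := (gT * symbol r)%type.

Definition dinv (s : dsegment) : dsegment :=
  ((s.1 * symbol_val s.2)%g, symbol_inv s.2).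

Lemma dinv_neq s : dinv s != s.
Proof. by case: s => F x; rewrite xpair_eqE negb_and symbol_inv_neq orbT. Qed.

Lemma dinvK : involutive dinv.
Proof.
case=> F [i b]; rewrite /dinv /symbol_inv /symbol_val /= negbK.
by case: b => /=; rewrite ?mulgK ?mulgKV.
Qed.

Definition group_diagram : lineComplex :=
  @LineComplex gT dsegment fst dinv dinv_neq dinvK.

(* A cyclic ordering of the symbols is given by a list [c] of all of them, read
   cyclically; the segments at each point are ordered like their symbols. *)
Definition diagram_next (c : seq (symbol r))
    (s : segment group_diagram) : segment group_diagram :=
  (s.1, next c s.2).

Definition carried (s : segment group_diagram) : segment (bouquet r) := s.2.

End GroupDiagram.

(* Main.v *)
Require Import Defs.
From mathcomp Require Import all_boot all_fingroup.

Set Implicit Arguments.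
Unset Strict Implicit.
Unset Printing Implicit Defensive.

(** The argument is the theory of rotation systems (combinatorial maps).
Segments with a reversal [flip] and a bijection [ccw] that turns around each
point determine surfaces by face tracing: the positive boundary paths are the
orbits of [s |-> ccw (flip s)]. Reading such a path backwards gives an orbit of
[s |-> cw (flip s)], with [cw] the inverse of [ccw]; the pieces are
therefore pairs of a sign and an orbit of the corresponding [step], and every
statement about boundaries is proved for both signs at once.

An orbit of [step b] runs through each segment at most once, and each segment
lies on exactly one orbit of each sign. This is the orientation, and it bounds
the passages through a segment by two ([faces_manifold]); the star condition
holds because turning by [ccw] reaches every segment at a point, each turn being
a corner of a positive piece and, read backwards, of a negative one.

A map [h] that commutes with [flip] and [ccw] and is bijective on stars commutes
with [step], so an orbit of length [k * m] is wound [k] times around an orbit of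
length [m]: this is a covering, branched where [k > 1] ([face_map_covering]).
The group diagram and the bouquet are both rotation systems for the given cyclic
order of the symbols, and forgetting the group element is such a map. It is
regular because paths with the same symbols are left translates of each other
([diagram_regular]). That the [S i] generate the group makes the diagram
connected ([diagram_connected]). *)

(** * Orbits of a map on a finite type *)

Section Orbits.
Variables (T : finType) (f : T -> T).
Implicit Types (x y : T) (w : seq T).

Lemma iter_modn_order x n : injective f ->
  iter (n %% fingraph.order f x) f x = iter n f x.
Proof.
move=> injf; rewrite [in RHS](divn_eq n (fingraph.order f x)) addnC iterD.
congr (iter _ f _); elim: (n %/ _) => // k IHk.
by rewrite mulSn iterD -IHk iter_order.
Qed.

(** The return times of an orbit are the multiples of its length: the remainder of
[n] is smaller than the order, so it is the [findex] of [x] from itself. *)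
Lemma order_dvd x n : injective f ->
  iter n f x = x -> fingraph.order f x %| n.
Proof.
move=> injf fnx; rewrite /dvdn -(findex_iter (ltn_pmod n (fingraph.order_gt0 f x))).
by rewrite iter_modn_order // fnx findex0.
Qed.

Lemma orbit_head x : fingraph.orbit f x = x :: behead (fingraph.orbit f x).
Proof. by rewrite /fingraph.orbit -orderSpred. Qed.

(** The converse reading of [orbit_rot_cycle], which presents the orbit as a
rotation of [w]. *)
Lemma fcycle_uniq_orbit w x :
  fcycle f w -> uniq w -> x \in w -> exists n, w = rot n (fingraph.orbit f x).
Proof.
move=> fw uw xw; have [i ->] := orbit_rot_cycle fw uw xw.
by exists (size (rot i w) - i); apply/esym/rotK.
Qed.

Lemma rot_orbit x n : injective f ->
  exists2 y, fconnect f x y & rot n (fingraph.orbit f x) = fingraph.orbit f y.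
Proof.
move=> injf; set w := rot n _.
have [fw uw]: fcycle f w /\ uniq w.
  by rewrite rot_cycle rot_uniq orbit_uniq cycle_orbit.
have sz: size w = fingraph.order f x by rewrite size_rot size_orbit.
have mw y: y \in w = fconnect f x y by rewrite mem_rot fconnect_orbit.
clearbody w; case: w => [|y w] in fw uw sz mw *.
  by have := fingraph.order_gt0 f x; rewrite -sz.
exists y; first by rewrite -mw mem_head.
by rewrite (fcycle_consE fw) /fingraph.orbit (order_cycle fw uw (mem_head y w)).
Qed.

(** This cuts an orbit of length [k * m] into the [k] laps [w_i] of a branched
covering. *)
Lemma traject_mul x k m :
  traject f x (k * m) =
  flatten [seq traject f (iter (i * m) f x) m | i <- iota 0 k].
Proof.
elim: k => // k IHk; rewrite mulSnr trajectD IHk -addn1 iotaD map_cat.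
by rewrite flatten_cat /= cats0.
Qed.

End Orbits.

Lemma map_traject (T T' : Type) (h : T -> T') (f : T -> T) (g : T' -> T') x n :
  {morph h : y / f y >-> g y} -> map h (traject f x n) = traject g (h x) n.
Proof. by move=> hf; elim: n x => //= n IHn x; rewrite IHn hf. Qed.

(** * Rotation systems and their faces *)

(** The segments at one point form a single cycle of [ccw]; the inverse [cw] is a
field so that reversing the orientation exchanges two functions of the same
kind. *)
Record rotationSystem := RotationSystem {
  base : eqType;
  dart : finType;
  origin : dart -> base;
  flip : dart -> dart;
  flip_neq : forall s, flip s != s;
  flipK : involutive flip;
  ccw : dart -> dart;
  cw : dart -> dart;
  ccwK : cancel ccw cw;
  cwK : cancel cw ccw;
  origin_ccw : forall s, origin (ccw s) = origin s;
  ccw_transitive : forall s t, origin s = origin t -> fconnect ccw s t }.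

Definition complex_of (R : rotationSystem) : lineComplex :=
  @LineComplex (base R) (dart R) (@origin R) (@flip R) (@flip_neq R) (@flipK R).

Section Faces.
Variable R : rotationSystem.
Implicit Types (b : bool) (s t u : dart R).

Definition swing b s := if b then ccw s else cw s.

Lemma swingK b : cancel (swing b) (swing (~~ b)).
Proof. by case: b => s; rewrite /swing /= (ccwK, cwK). Qed.

Lemma origin_swing b s : origin (swing b s) = origin s.
Proof.
by case: b; rewrite /swing ?origin_ccw // -[in RHS](cwK s) origin_ccw.
Qed.

Definition step b s := swing b (flip s).

Lemma step_inj b : injective (step b).
Proof. exact: inj_comp (can_inj (swingK b)) (can_inj (@flipK R)). Qed.

(** Reversal exchanges the two signs: it turns a positive boundary path into a
negative one, traversed backwards. *)
Lemma step_flip b s : step (~~ b) (flip (step b s)) = flip s.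
Proof. by rewrite /step flipK swingK. Qed.

Lemma origin_step b s : origin (step b s) = origin (flip s).
Proof. exact: origin_swing. Qed.

Definition face_repr b s := froot (step b) s.

(** An orbit of [step b] is encoded by [b] and its canonical representative, which
makes faces a type with decidable equality. *)
Definition face := {f : bool * dart R | face_repr f.1 f.2 == f.2}.

Definition sign (f : face) : bool := (val f).1.

Lemma face_at_subproof b s : face_repr b (face_repr b s) == face_repr b s.
Proof. by rewrite /face_repr root_root //; apply/fconnect_sym/step_inj. Qed.

Definition face_at b s : face :=
  exist (fun f : bool * dart R => face_repr f.1 f.2 == f.2)
    (b, face_repr b s) (face_at_subproof b s).

Lemma face_atP b s t : reflect (face_at b s = face_at b t) (fconnect (step b) s t).
Proof.
apply: (iffP (fingraph.rootP (fconnect_sym (@step_inj b)))) => [e | [] //].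
by apply: val_inj; rewrite /= /face_repr e.
Qed.

Lemma face_at_step b s : face_at b (step b s) = face_at b s.
Proof. by apply/esym/face_atP/fconnect1. Qed.

Lemma face_at_repr (f : face) : face_at (sign f) (val f).2 = f.
Proof.
by apply: val_inj => /=; rewrite (eqP (valP f)) /sign -surjective_pairing.
Qed.

Lemma faceP (f : face) : exists s, f = face_at (sign f) s.
Proof. by exists (val f).2; rewrite face_at_repr. Qed.

Definition face_inv (f : face) : face := face_at (~~ sign f) (flip (val f).2).

(** The definition of [face_inv] uses the representative; any other segment of the
orbit serves as well, since moving it one step moves its reversal back one step
of the opposite sign. *)
Lemma face_inv_at b s : face_inv (face_at b s) = face_at (~~ b) (flip s).
Proof.
have flip_step t: face_at (~~ b) (flip (step b t)) = face_at (~~ b) (flip t).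
  by rewrite -(face_at_step _ (flip (step b t))) step_flip.
have: fconnect (step b) s (face_repr b s) by apply: connect_root.
rewrite /face_inv /= => /iter_findex <-.
by elim: (findex _ _ _) => //= n IHn; rewrite flip_step.
Qed.

Lemma sign_inv f : sign (face_inv f) = ~~ sign f. Proof. by []. Qed.

Lemma face_inv_neq f : face_inv f != f.
Proof. by apply/eqP => /(congr1 sign); rewrite sign_inv; case: (sign f). Qed.

Lemma face_invK : involutive face_inv.
Proof.
by move=> f; have [s ->] := faceP f; rewrite !face_inv_at negbK flipK.
Qed.

Definition face_bd (f : face) : seq (segment (complex_of R)) :=
  fingraph.orbit (step (sign f)) (val f).2.

Lemma fcycle_closed_path b (w : seq (dart R)) :
  w != [::] -> fcycle (step b) w -> closed_path (w : seq (segment (complex_of R))).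
Proof.
rewrite /closed_path => -> /=; apply: sub_cycle => s t /= /eqP <-.
by rewrite /follows /final /= origin_step.
Qed.

Lemma orbit_closed_path b s :
  closed_path (fingraph.orbit (step b) s : seq (segment (complex_of R))).
Proof.
apply: (@fcycle_closed_path b); first by rewrite orbit_head.
exact/cycle_orbit/step_inj.
Qed.

Lemma face_bd_closed f : closed_path (face_bd f).
Proof. exact: orbit_closed_path. Qed.

(** A segment lies on one face of each sign, so counting passages reduces to
comparing faces. *)
Lemma mem_face_bd f s : (s \in face_bd f) = (f == face_at (sign f) s).
Proof.
rewrite /face_bd -fconnect_orbit -{3}(face_at_repr f).
by apply/face_atP/eqP.
Qed.

Lemma mem_face_bd_inv f s : (s \in face_bd (face_inv f)) = (flip s \in face_bd f).
Proof.
rewrite !mem_face_bd sign_inv -(can_eq face_invK) face_invK face_inv_at.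
by rewrite negbK.
Qed.

Lemma face_bd_inv f : exists n, path_inv (face_bd f) = rot n (face_bd (face_inv f)).
Proof.
set w := path_inv _.
have fw: fcycle (step (~~ sign f)) w.
  rewrite /w /path_inv rev_cycle cycle_map.
  apply: sub_cycle (cycle_orbit (@step_inj (sign f)) (val f).2) => s t /=.
  by move/eqP=> <-; rewrite step_flip.
have uw: uniq w.
  by rewrite rev_uniq map_inj_uniq ?orbit_uniq //; apply: can_inj (@flipK R).
apply: fcycle_uniq_orbit => //.
rewrite mem_rev -[X in X \in _](@flipK R) map_f // -mem_face_bd_inv mem_face_bd.
by rewrite face_at_repr.
Qed.

Definition faces : surfaceComplex (complex_of R) :=
  @SurfaceComplex (complex_of R) face face_inv face_inv_neq face_invK
    face_bd face_bd_closed face_bd_inv.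

Implicit Types (f g : piece faces).

Lemma boundary_pathP f (w : seq (dart R)) :
  boundary_path f w <->
  exists2 s, f = face_at (sign f) s & w = fingraph.orbit (step (sign f)) s.
Proof.
split=> [[n ->] | [s ef ->]].
  have [s /face_atP es ->] := rot_orbit (val f).2 n (@step_inj (sign f)).
  by exists s; rewrite // -es face_at_repr.
apply: fcycle_uniq_orbit; rewrite ?orbit_uniq //.
  exact/cycle_orbit/step_inj.
by rewrite -fconnect_orbit; apply/face_atP; rewrite face_at_repr -ef.
Qed.

(** A boundary path starting at [s] follows the orbit of [s] and closes up only
after a whole number of laps. Minimality leaves one lap; conversely a boundary
path inside a lap already fills an orbit, hence the lap. *)
Lemma simple_order_boundaryP (w : seq (dart R)) :
  simple_order_boundary (@ccw R : segment (complex_of R) -> _) w <->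
  exists s, w = fingraph.orbit (step true) s.
Proof.
have order_boundary_orbit s :
    order_boundary (@ccw R : segment (complex_of R) -> _)
      (fingraph.orbit (step true) s).
  rewrite /order_boundary orbit_closed_path.
  exact/cycle_orbit/(@step_inj true).
have infix_size (u v : seq (dart R)) : infix u v -> size v <= size u -> u = v.
  case/infixP=> [v1 [v2 ->]]; rewrite !size_cat addnCA -[leqRHS]addn0 leq_add2l.
  by rewrite leqn0 addn_eq0 !size_eq0 => /andP[/eqP-> /eqP->]; rewrite cats0.
split=> [[] | [s ->]].
  case: w => // s w /andP[_ fw] w_simple; exists s.
  apply/eqP; apply/negPn/negP => /eqP ws.
  suff /w_simple/(_ (nesym ws))/negP[] :
      infix (fingraph.orbit (step true) s) (s :: w).
    exact: order_boundary_orbit.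
  have sz: fingraph.order (step true) s <= (size w).+1.
    exact: (order_le_cycle fw (mem_head s w)).
  rewrite (fcycle_consE fw) /fingraph.orbit -(take_traject _ _ sz).
  exact: infix_take.
split=> // u us u_neq; apply/negP => /andP[/andP[u0 _] fu].
case: u => // t u in us u_neq u0 fu *; apply: u_neq; apply: infix_size => //.
have ts: t \in fingraph.orbit (step true) s by rewrite (mem_infix us) ?mem_head.
have fs := cycle_orbit (@step_inj true) s.
rewrite -(order_cycle fs (orbit_uniq _ _) ts).
exact: (order_le_cycle fu (mem_head t u)).
Qed.

Lemma positive_boundaryP (w : seq (dart R)) :
  (exists f, sign f /\ boundary_path f w) <->
  simple_order_boundary (@ccw R : segment (complex_of R) -> _) w.
Proof.
apply: iff_trans (iff_sym (simple_order_boundaryP w)).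
split=> [[f [pos_f /boundary_pathP[s _ ->]]] | [s ->]].
  by exists s; rewrite pos_f.
by exists (face_at true s); split=> //; apply/boundary_pathP; exists s.
Qed.

Lemma count_face_bd f s : count_mem s (bd f) = (f == face_at (sign f) s).
Proof. by rewrite count_uniq_mem ?orbit_uniq // mem_face_bd. Qed.

Lemma runsE f s :
  runs f s = (f == face_at (sign f) s) + (f == face_at (sign f) (flip s)).
Proof. by rewrite /runs !count_face_bd. Qed.

Lemma faces_orientation : is_orientation (sign : pred (piece faces)).
Proof.
split=> // s; exists (face_at true s); split=> //.
  by rewrite count_face_bd eqxx.
by move=> g pos_g; rewrite mem_face_bd pos_g => /eqP.
Qed.

(** In the face through the reversal of [s], the segment after [flip s] is
[step b (flip s) = swing b s]. *)
Lemma corner_exists b s :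
  exists j, @corner _ faces (face_at b (flip s)) j s (swing b s).
Proof.
set f : piece faces := face_at b (flip s).
have fs: flip s \in bd f by rewrite mem_face_bd.
exists (index (flip s) (bd f)).
have sz: size (bd f) = fingraph.order (step b) (val f).2 by apply: size_orbit.
have nth_bd i : nth s (bd f) (i %% size (bd f)) = iter i (step b) (val f).2.
  have lt_i := ltn_pmod i (fingraph.order_gt0 (step b) (val f).2).
  rewrite sz -(iter_modn_order _ _ (@step_inj b)) -(nth_traject _ lt_i).
  by apply: set_nth_default; rewrite size_traject.
split; rewrite ?index_mem ?nth_index // nth_bd iterS -nth_bd.
by rewrite modn_small ?index_mem // nth_index // /step flipK.
Qed.

(** For consecutive segments [s], [t], [u], the corner from [s] to [t] is in a
positive piece and the corner from [u] to [t] in a negative one, so the two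
passages through [t] differ. *)
Lemma joined_around_ccw c : sorted (frel (@ccw R)) c -> @joined_around _ faces c.
Proof.
move=> c_ccw; split=> [c1 c2 s t | c1 c2 s t u] ec; move: c_ccw; rewrite ec.
  case/cat_sorted2 => _ /= /andP[/eqP <- _].
  by exists (face_at true (flip s)); apply: corner_exists.
case/cat_sorted2 => _ /= /and3P[/eqP <- /eqP <- _]; set t' := ccw s.
have [j js] := corner_exists true s.
have [j' ju] := corner_exists false (ccw t').
exists (face_at true (flip s)), j, (face_at false (flip (ccw t'))), j'.
by split=> //; rewrite /swing ccwK in ju.
Qed.

(** A segment bounds, up to orientation, only the faces of fixed sign through it
and through its reversal; these may coincide. *)
Lemma runs_cases b f s : 0 < runs f s ->
  [\/ f = face_at b s, f = face_inv (face_at b s), f = face_at b (flip s)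
    | f = face_inv (face_at b (flip s))].
Proof.
rewrite runsE addn_gt0 !lt0b !face_inv_at flipK.
have [-> | ->] : sign f = b \/ sign f = ~~ b.
  by case: b; case: (sign f); [left | right | right | left].
by case/orP=> /eqP ->; [constructor 1 | constructor 3].
by case/orP=> /eqP ->; [constructor 4 | constructor 2].
Qed.

Lemma faces_manifold : connected (complex_of R) -> is_manifold faces.
Proof.
move=> conn; split=> //.
- by move=> s; exists (face_at true s); rewrite runsE eqxx.
- by move=> f s; rewrite runsE (leq_add (leq_b1 _) (leq_b1 _)).
- move=> f s runs1; set b := sign f.
  (* As [runs] ignores direction, [s] may be reversed to lie on [f] itself. *)
  have [t [ef ne runs_t]] : exists t,
      [/\ f = face_at b t, f <> face_at b (flip t) & forall g, runs g s = runs g t].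
    move: runs1; rewrite runsE -/b; case: eqP; case: eqP => // ne e _.
      by exists s.
    by exists (flip s); rewrite flipK; split=> // g; rewrite !runsE flipK addnC.
  exists (face_at b (flip t)); split.
  + exact/nesym.
  + by move/(congr1 sign); rewrite sign_inv /b; case: (sign f).
  + by rewrite runs_t runsE eqxx eq_sym -ef; case: eqP.
  by move=> g g_f g_f'; rewrite runs_t => /(runs_cases b)[] eg;
    [case: g_f | case: g_f' | left | right]; rewrite eg // -ef.
- move=> f s; rewrite runsE; case: eqP => //; case: eqP => // ef' ef _ g.
  case/(runs_cases (sign f)); rewrite -?ef -?ef'; by [left | right].
move=> s t /ccw_transitive/connectP[c sc ->]; exists c; split=> //.
  move=> u; elim: c s sc => //= v c IHc s /andP[/eqP <- {}/IHc IHc].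
  by rewrite inE => /predU1P[->| /IHc ->]; rewrite origin_ccw.
exact: joined_around_ccw.
Qed.

End Faces.

(** * Coverings from maps of rotation systems *)

Section FaceMap.
Variables (R R' : rotationSystem).
Variables (hp : base R -> base R') (h : dart R -> dart R').
Hypothesis hp_onto : forall p', exists p, hp p = p'.
Hypothesis origin_h : forall s, origin (h s) = hp (origin s).
Hypothesis h_flip : {morph h : s / flip s}.
Hypothesis h_ccw : {morph h : s / ccw s}.
Hypothesis h_star :
  forall p s', origin s' = hp p -> exists! s, origin s = p /\ h s = s'.
Implicit Types (b : bool) (s t : dart R).

Lemma h_step b : {morph h : s / step b s}.
Proof.
move=> s; rewrite /step -h_flip; move: (flip s) => t.
case: b; rewrite /swing ?h_ccw //; apply: (can_inj (@ccwK R')).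
by rewrite -h_ccw !cwK.
Qed.

Lemma h_iter b n s : h (iter n (step b) s) = iter n (step b) (h s).
Proof. by elim: n => //= n <-; rewrite h_step. Qed.

Lemma h_star_inj s t : origin s = origin t -> h s = h t -> s = t.
Proof.
move=> pst hst; have [u [_ u_uniq]] := h_star (origin_h s).
by rewrite -(u_uniq s) // (u_uniq t).
Qed.

Definition face_map : complexMap (faces R) (faces R') :=
  @ComplexMap (complex_of R) (complex_of R') (faces R) (faces R')
    hp h (fun f : face R => face_at (sign f) (h (val f).2)).

Lemma face_map_at b s : piece_map face_map (face_at b s) = face_at b (h s).
Proof.
have: fconnect (step b) s (face_repr b s) by apply: connect_root.
move/iter_findex=> /=; rewrite /sign /= => <-; rewrite h_iter.
by apply/esym/face_atP/fconnect_iter.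
Qed.

Lemma face_map_inv (f : face R) :
  piece_map face_map (face_inv f) = face_inv (piece_map face_map f).
Proof.
by have [s ->] := faceP f; rewrite face_inv_at !face_map_at face_inv_at h_flip.
Qed.

Lemma order_map_dvd b s :
  fingraph.order (step b) (h s) %| fingraph.order (step b) s.
Proof.
apply: (order_dvd (@step_inj _ b)).
by rewrite -h_iter iter_order //; apply: step_inj.
Qed.

(** Lifts are unique: the segment after [s] is determined by its initial point, the
final point of [s], and by its image; [step b s] has both. *)
Lemma path_lift_traject b (s' : dart R') s (w : seq (dart R)) :
  @is_path (complex_of R) (s :: w) ->
  map h (s :: w) = traject (step b) s' (size w).+1 ->
  s :: w = traject (step b) s (size w).+1.
Proof.
elim: w s s' => //= t w IHw s s' /andP[/eqP st tw] [hs ht hw].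
have et : t = step b s.
  apply: h_star_inj; last by rewrite ht h_step hs.
  by rewrite origin_step; apply: esym st.
by rewrite {1}(IHw t (step b s') tw) /= ?ht ?hw // et.
Qed.

(** The image of an orbit of length [k * m] is [k] laps of an orbit of length [m].
Conversely a lift of one lap starts the orbit of its first segment, and that
segment lies on a single face of the given sign. *)
Lemma face_map_covering : is_covering face_map.
Proof.
split=> //.
- exact: face_map_inv.
- move=> f r /boundary_pathP; set b := sign f => -[s ef ->].
  set m := fingraph.order (step b) (h s).
  have m_gt0 : 0 < m by apply: fingraph.order_gt0.
  have [k Ekm] := dvdnP (order_map_dvd b s); rewrite -/m in Ekm.
  have hm i : iter (i * m) (step b) (h s) = h s.
    by rewrite -(iter_modn_order _ _ (@step_inj _ b)) modnMl.
  have h_lap i : map h (traject (step b) (iter (i * m) (step b) s) m)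
      = fingraph.orbit (step b) (h s).
    by rewrite (map_traject _ _ (@h_step b)) h_iter hm.
  (* The laps [ws] are distinct because their initial segments are distinct. *)
  set ws := [seq traject (step b) (iter (i * m) (step b) s) m | i <- iota 0 k].
  have flat_ws : fingraph.orbit (step b) s = flatten ws.
    by rewrite /fingraph.orbit Ekm traject_mul.
  have h_ws : map (map h) ws = nseq k (fingraph.orbit (step b) (h s)).
    rewrite -map_comp (eq_map h_lap) -[in RHS](size_iota 0 k).
    by elim: iota => //= ? ? ->.
  exists k, (fingraph.orbit (step b) (h s)), ws; split=> //.
  + by apply/boundary_pathP; exists (h s); rewrite // ef face_map_at.
  + by rewrite flat_ws map_flatten h_ws.
  rewrite map_inj_in_uniq ?iota_uniq // => i j.
  rewrite !mem_iota /= => lt_i lt_j.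
  rewrite -(prednK m_gt0) !trajectS => -[eij _].
  have lt_km l : l < k -> l * m < fingraph.order (step b) s.
    by rewrite Ekm ltn_pmul2r.
  apply/eqP; rewrite -(eqn_pmul2r m_gt0); apply/eqP.
  rewrite prednK // in eij.
  by rewrite -(findex_iter (lt_km _ lt_i)) eij findex_iter ?lt_km.
move=> f' r' w /boundary_pathP; set b := sign f' => -[s' ef' ->].
case: w => [|s w] pw; first by rewrite orbit_head.
move=> hw; have hs : h s = s' by move: hw; rewrite orbit_head => -[].
have sz : (size w).+1 = fingraph.order (step b) s'.
  by have /= := congr1 size hw; rewrite size_map size_orbit.
have -> : s :: w = traject (step b) s (fingraph.order (step b) s').
  by rewrite -sz; apply: (path_lift_traject pw (s' := s')); rewrite sz.
exists (face_at b s); split=> [|f [ff' [v /boundary_pathP[t ef]]]].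
  split; first by rewrite face_map_at hs.
  exists (drop (fingraph.order (step b) s') (fingraph.orbit (step b) s)).
  apply/boundary_pathP; exists s => //.
  rewrite -[RHS](cat_take_drop (fingraph.order (step b) s')) take_traject //.
  by rewrite dvdn_leq ?fingraph.order_gt0 // -hs order_map_dvd.
have sf: sign f = b by rewrite /b -ff'.
rewrite orbit_head -(prednK (fingraph.order_gt0 _ s')) trajectS => -[est _].
by rewrite ef est sf.
Qed.

End FaceMap.

(** * The group diagram and the bouquet *)

Section Diagram.
Variables (gT : finGroupType) (r : nat) (S : 'I_r -> gT).
Implicit Types (x y : symbol r) (F : gT).

(** Since the group is finite, every element is a product of generators, so paths
along positive symbols suffice. *)
Lemma diagram_connected :
  (<<[set S i | i : 'I_r]>>)%g = [set: gT] -> connected (group_diagram S).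
Proof.
move=> S_gen p q.
have : (p^-1 * q)%g \in <<[set S i | i : 'I_r]>>%g by rewrite S_gen inE.
rewrite -[in X in _ -> X](mulKVg p q).
move: (p^-1 * q)%g => _ /gen_prodgP[n [a a_in ->]].
elim: n a a_in => [|n IHn] a a_in; first by left; rewrite big_ord0 mulg1.
rewrite big_ord_recr mulgA /=; right.
have /imsetP[i _ ->] := a_in ord_max.
have [|<-|[s [w [<- sw <-]]]] := IHn (fun j => a (widen_ord (leqnSn n) j)).
- by move=> j; apply: a_in.
- by exists (p, (i, true) : symbol r), [::].
exists s, (rcons w (final (last s w), (i, true) : symbol r)); split=> //.
  by rewrite rcons_path sw /follows eqxx.
by rewrite last_rcons.
Qed.

(** Two paths with the same symbols differ by left translation, an automorphism of
the diagram that preserves the symbols. *)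
Lemma diagram_regular (w w' : seq (segment (group_diagram S))) :
  is_path w -> is_path w' -> map (@carried gT r S) w = map (@carried gT r S) w' ->
  closed_path w -> closed_path w'.
Proof.
move=> pw pw' ew.
have [F ->] : exists F, w' = [seq ((F * s.1)%g, s.2) | s <- w].
  case: w w' pw pw' ew => [|[F x] w] [|[F' x'] w'] //=; first by exists 1%g.
  rewrite {1 2}/carried /= => Fw Fw' [ex ew]; rewrite -{x'}ex in Fw' *.
  exists (F' * F^-1)%g; rewrite mulgKV; congr cons.
  elim: w w' F F' x Fw Fw' ew => [|[G y] w IHw] [|[G' y'] w'] //= F F' x.
  case/andP=> /eqP /= <- Gw /andP[/eqP /= <- Gw'] [ey ew].
  rewrite -{y'}ey in Gw' *.
  rewrite (IHw w' _ _ y Gw Gw' ew) /final /= mulgA mulgKV; congr cons.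
  by apply: eq_map => s; rewrite invMg !mulgA mulgK.
case/andP=> w_neq0 w_closed; apply/andP; split; first by case: (w) w_neq0.
apply: (@homo_cycle _ _ _ _ (@follows (group_diagram S))) w_closed.
move=> s t /eqP; rewrite /follows /final /= => <-.
by rewrite mulgA.
Qed.

Variables (c : seq (symbol r)) (c_uniq : uniq c) (c_all : forall x, x \in c).

Definition diagram_prev (s : segment (group_diagram S)) :
    segment (group_diagram S) :=
  (s.1, prev c s.2).

Lemma diagram_nextK : cancel (@diagram_next gT r S c) diagram_prev.
Proof. by case=> F x; rewrite /diagram_prev /= prev_next. Qed.

Lemma diagram_prevK : cancel diagram_prev (@diagram_next gT r S c).
Proof. by case=> F x; rewrite /diagram_next /= next_prev. Qed.

Lemma next_transitive x y : fconnect (next c) x y.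
Proof. by rewrite (fconnect_cycle (cycle_next c_uniq)). Qed.

Lemma diagram_next_transitive (s t : gT * ('I_r * bool)) :
  s.1 = t.1 -> fconnect (@diagram_next gT r S c : _ -> gT * ('I_r * bool)) s t.
Proof.
case: s t => F x [_ y] /= <-; have /iter_findex <- := next_transitive x y.
elim: (findex _ _ _) => //= n IHn; apply: connect_trans IHn _.
exact: fconnect1.
Qed.

(** The type of segments is written out as a product because [symbol] and
[dsegment] only carry decidable equality; [complex_of diagram_rotation] is
convertible to [group_diagram S], and likewise for the bouquet. *)
Definition diagram_rotation : rotationSystem :=
  @RotationSystem gT (gT * ('I_r * bool))%type fst (@dinv gT r S)
    (@dinv_neq gT r S) (@dinvK gT r S) (@diagram_next gT r S c) diagram_prev
    diagram_nextK diagram_prevK (fun=> erefl) diagram_next_transitive.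

Definition bouquet_rotation : rotationSystem :=
  @RotationSystem unit ('I_r * bool)%type (fun=> tt) (@symbol_inv r)
    (@symbol_inv_neq r) (@symbol_invK r) (next c) (prev c)
    (prev_next c_uniq) (next_prev c_uniq) (fun=> erefl)
    (fun s t _ => next_transitive s t).

End Diagram.

Theorem mainTheorem6 (gT : finGroupType) (r : nat) (S : 'I_r -> gT)
    (S_gen : (<<[set S i | i : 'I_r]>>)%g = [set: gT])
    (c : seq (symbol r)) (c_uniq : uniq c) (c_all : forall x, x \in c) :
  exists (M : surfaceComplex (group_diagram S)) (pos : pred (piece M)),
    [/\ is_manifold M,
        is_orientation pos,
        (forall w : seq (segment (group_diagram S)),
          (exists f, pos f /\ boundary_path f w)
            <-> simple_order_boundary (@diagram_next gT r S c) w)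
      & exists (M' : surfaceComplex (bouquet r)) (A : complexMap M M'),
          [/\ is_manifold M',
              (exists pos' : pred (piece M'), is_orientation pos'),
              is_covering A,
              regular A
            & forall s, segment_map A s = carried s]].
Proof.
pose R := diagram_rotation S c_uniq c_all; pose R' := bouquet_rotation c_uniq c_all.
exists (faces R), (@sign R); split.
- exact: (@faces_manifold R (diagram_connected S_gen)).
- exact: (@faces_orientation R).
- exact: (@positive_boundaryP R).
exists (faces R'), (@face_map R R' (fun=> tt) (@carried gT r S)); split=> //.
- by apply: (@faces_manifold R') => -[] []; left.
- by exists (@sign R'); apply: (@faces_orientation R').
- apply: (@face_map_covering R R') => //; first by case; exists 1%g.
  move=> F x _; exists (F, x); split=> // -[G y] /= [<- <-] //.
exact: diagram_regular.
Qed.
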